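(* Let $N\ge 1$ be an integer, $\alpha\in(0,1]$, and $\lambda,c$ real constants with $c>0$. Consider the $N$-dimensional fractional Klein–Gordon equation $$\left(\frac{\partial^2}{\partial t^2}-c^2\Delta\right)^{\alpha}u_{\alpha}(\mathbf{x},t)=-\lambda^2u_{\alpha}(\mathbf{x},t),\qquad \mathbf{x}=(x_1,\dots,x_N)\in\mathbb{R}^N,$$ for functions of the form $u_\alpha(\mathbf{x},t)=f(w)$ with $w=\left(c^2t^2-\sum_{j=1}^N x_j^2\right)^{1/2}>0$, for which the equation means $$\left(\frac{d^2}{dw^2}+\frac{N}{w}\frac{d}{dw}\right)^{\alpha}f(w)=-\frac{\lambda^2}{c^{2\alpha}}f(w),\quad\text{where}\quad \left(\frac{d^2}{dw^2}+\frac{N}{w}\frac{d}{dw}\right)^{\alpha}f(w):=4^{\alpha}w^{-2\alpha}I_2^{0,-\alpha}I_2^{\frac{N-1}{2},-\alpha}f(w).$$ Then a solution is given by $$u_\alpha(\mathbf{x},t)=\sum_{k=0}^{\infty}\left(\frac{\lambda}{2^{\alpha}c^{\alpha}}\right)^{2k}\frac{(-1)^k\left(c^2t^2-\sum_{j=1}^N x_j^2\right)^{\alpha k+\alpha-1}}{\Gamma\!\left(\alpha k+\alpha+\frac{N-1}{2}\right)\Gamma(\alpha k+\alpha)} =\left(c^2t^2-\sum_{j=1}^N x_j^2\right)^{\alpha-1}E^{(2)}_{(\alpha,\alpha),(\alpha,\alpha+\frac{N-1}{2})}\!\left[-\left(\frac{\lambda\left(c^2t^2-\sum_{j=1}^N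 x_j^2\right)^{\alpha/2}}{2^{\alpha}c^{\alpha}}\right)^{2}\right].$$
   Context: Erdélyi–Kober operators (McBride's notation): for $m>0$, $\eta\in\mathbb{R}$ and $\alpha>0$, $$I_m^{\eta,\alpha}f(x)=\frac{x^{-m\eta-m\alpha}}{\Gamma(\alpha)}\int_0^x(x^m-u^m)^{\alpha-1}u^{m\eta}f(u)\,d(u^m),$$ and for $\alpha\le 0$ recursively $I_m^{\eta,\alpha}f=(\eta+\alpha+1)I_m^{\eta,\alpha+1}f+\frac{1}{m}I_m^{\eta,\alpha+1}\left(x\frac{d}{dx}f\right)$. The fractional operator in $w$ is McBride's fractional power of the hyper-Bessel operator $w^{-N}\frac{d}{dw}w^{N}\frac{d}{dw}$ (parameters $a_1=-N,a_2=N,a_3=0$, $m=2$, $b_1=\frac{N-1}{2}$, $b_2=0$); the change of variable $w$ turns $\frac{\partial^2}{\partial t^2}-c^2\Delta$ acting on $f(w)$ into $c^2\left(\frac{d^2}{dw^2}+\frac{N}{w}\frac{d}{dw}\right)f$. The multi-index Mittag-Leffler function is $E^{(n)}_{(\alpha_i)^n,(\mu_i)^n}(z)=\sum_{k=0}^\infty\frac{z^k}{\Gamma(\alpha_1k+\mu_1)\cdots\Gamma(\alpha_nk+\mu_n)}$. *)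

(* Defs.v *)
From mathcomp Require Import all_boot all_order all_algebra.
From mathcomp Require Import all_classical all_reals all_analysis.
Set Implicit Arguments. Unset Strict Implicit. Unset Printing Implicit Defensive.
Import Order.TTheory GRing.Theory Num.Theory numFieldNormedType.Exports.
Local Open Scope classical_set_scope.
Local Open Scope ring_scope.

(* Euler's Gamma function, Gamma(s) = int_0^oo t^(s-1) e^(-t) dt (used only for s > 0). *)
Definition Gamma (R : realType) (s : R) : R :=
  Rintegral lebesgue_measure `]0%R, +oo[ (fun t : R => t `^ (s - 1) * expR (- t)).

(* Erdelyi-Kober operator for alpha > 0:
   I_m^{eta,alpha} f(x) = x^{-m eta - m alpha}/Gamma(alpha)
        * int_0^x (x^m-u^m)^{alpha-1} u^{m eta} f(u) d(u^m),   d(u^m) = m u^{m-1} du. *)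
Definition EK_pos (R : realType) (m eta a : R) (f : R -> R) (x : R) : R :=
  x `^ (- (m * eta) - m * a) / Gamma a *
  Rintegral lebesgue_measure `]0%R, x[
    (fun u : R => (x `^ m - u `^ m) `^ (a - 1) * u `^ (m * eta) * f u
                  * (m * u `^ (m - 1))).

(* n-fold unfolding of the recursion
   I_m^{eta,alpha} f = (eta+alpha+1) I_m^{eta,alpha+1} f + (1/m) I_m^{eta,alpha+1}(x f'). *)
Fixpoint EK_iter (R : realType) (n : nat) (m eta a : R) (f : R -> R) : R -> R :=
  match n with
  | 0%N => EK_pos m eta a f
  | n'.+1 => fun x =>
      (eta + a + 1) * EK_iter n' m eta (a + 1) f x
      + m^-1 * EK_iter n' m eta (a + 1) (fun y => y * derive1 f y) x
  end.

(* Number of recursion steps: 0 if alpha > 0, else the least n with alpha + n > 0. *)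
Definition EK_steps (R : realType) (a : R) : nat :=
  if 0 < a then 0%N else (Num.truncn (- a)).+1.

Definition EK (R : realType) (m eta a : R) (f : R -> R) : R -> R :=
  EK_iter (EK_steps a) m eta a f.

Definition frac_bessel (R : realType) (N : nat) (a : R) (f : R -> R) (w : R) : R :=
  4 `^ a * w `^ (- (2 * a)) *
  EK 2 0 (- a) (EK 2 ((N%:R - 1) / 2) (- a) f) w.

Definition mittag_leffler_multi (R : realType) (n : nat) (al mu : 'I_n -> R) (z : R) : R :=
  limn (series (fun k : nat => z ^+ k / \prod_(i < n) Gamma (al i * k%:R + mu i))).

Definition sol_term (R : realType) (N : nat) (a lam c s : R) (k : nat) : R :=
  (lam / (2 `^ a * c `^ a)) ^+ (2 * k) *
  ((-1) ^+ k * s `^ (a * k%:R + a - 1)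
   / (Gamma (a * k%:R + a + (N%:R - 1) / 2) * Gamma (a * k%:R + a))).

Definition sq_interval (R : realType) (N : nat) (c : R) (x : 'I_N -> R) (t : R) : R :=
  c ^+ 2 * t ^+ 2 - \sum_(j < N) x j ^+ 2.

Definition u_sol (R : realType) (N : nat) (a lam c : R) (x : 'I_N -> R) (t : R) : R :=
  limn (series (sol_term N a lam c (sq_interval c x t))).

Definition f_sol (R : realType) (N : nat) (a lam c : R) (w : R) : R :=
  limn (series (sol_term N a lam c (w ^+ 2))).

(* Main.v *)
(** The solution is a generalized power series in [w^(2a)], and Erdelyi-Kober
    operators act diagonally on powers: by Euler's Beta integral,
    [I_2^{eta,b} w^(2e) = Gamma (eta+e+1) / Gamma (eta+e+1+b) w^(2e)] for [b > 0],
    and since [x d/dx] is diagonal as well, the recursion to negative order only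
    continues the quotient via [Gamma (s+1) = s Gamma s].  Dominated convergence
    and termwise differentiation extend this to the series.  The composite
    [I_2^{0,-a} I_2^{(N-1)/2,-a}] thus turns the coefficient denominators
    [Gamma (a k + a + (N-1)/2) Gamma (a k + a)] into those of index [k - 1] and
    kills the term [k = 0], whose multiplier [s - a] vanishes; this shift is
    multiplication by [- lam^2 w^(2a) / (4^a c^(2a))]. *)
Require Import Defs.
From mathcomp Require Import all_boot all_order all_algebra.
From mathcomp Require Import all_classical all_reals all_analysis.
From mathcomp Require Import measurable_realfun ring lra.
Import Order.TTheory GRing.Theory Num.Theory numFieldNormedType.Exports.
Local Open Scope classical_set_scope.
Local Open Scope ring_scope.
Set Implicit Arguments. Unset Strict Implicit.
Local Notation mu := (@lebesgue_measure _).

(** * Change of variables on open intervals *)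

(** Substitution on compact segments passes to [D] by monotone convergence along such an exhaustion.
    The notion covers the bounded interval of the Erdelyi-Kober integral and the half-line of the
    Gamma integral alike. *)
Definition segment_exhausted (R : realType) (D : set R) : Prop :=
  open D /\ exists p q : nat -> R,
    [/\ nonincreasing_seq p, nondecreasing_seq q, forall n, p n <= q n
      & D = \bigcup_n `[p n, q n]%classic].

(** By the intermediate value theorem [F] maps each segment of the exhaustion onto a segment, where
    classical substitution applies. Both sides are then limits of the same sequence by monotone
    convergence, so the equality holds in the extended reals, infinite values included. *)
Lemma ge0_integral_image (R : realType) (D : set R) (F f G : R -> R) :
  segment_exhausted D ->
  {in D &, {homo F : x y / x < y}} ->
  (forall x, D x -> is_derive x 1 F (f x)) ->
  (forall x, D x -> {for x, continuous f}) ->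
  (forall x, D x -> {for F x, continuous G}) ->
  (forall x, D x -> 0 <= G (F x)) ->
  (\int[lebesgue_measure]_(x in F @` D) (G x)%:E =
   \int[lebesgue_measure]_(x in D) (G (F x) * f x)%:E)%E.
Proof.
move=> [oD [p [q [pN qN pq DE]]]] incF dF cf cG G0.
have segD n x : x \in `[p n, q n] -> D x by move=> xpq; rewrite DE; exists n.
have F'E x : D x -> derive1 F x = f x.
  by move=> /dF ?; rewrite derive1E derive_val.
have cF x : D x -> {for x, continuous F}.
  move=> /dF [dFx _]; exact/differentiable_continuous/derivable1_diffP.
have cF' x : D x -> {for x, continuous (derive1 F)}.
  move=> Dx; rewrite /prop_for /continuous_at F'E//.
  apply: cvg_trans (cf x Dx); apply: near_eq_cvg.
  have : nbhs x D by exact: open_nbhs_nbhs.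
  by apply: filterS => y /F'E.
have incFle x y : D x -> D y -> x <= y -> F x <= F y.
  move=> Dx Dy; rewrite le_eqVlt => /predU1P[->//|xy].
  by apply/ltW/incF => //; rewrite inE.
have Dp n : D (p n) by apply: (segD n); rewrite in_itv/= lexx pq.
have Dq n : D (q n) by apply: (segD n); rewrite in_itv/= lexx pq.
have withinF n : {within `[p n, q n], continuous F}.
  by apply: continuous_in_subspaceT => x; rewrite inE/= => /segD /cF.
have imF n : F @` `[p n, q n] = `[F (p n), F (q n)]%classic.
  apply/seteqP; split => [_ [x xpq <-]|y]/=.
    have Dx := segD _ _ xpq.
    move: xpq; rewrite /= !in_itv/= => /andP[px xq].
    by apply/andP; split; apply: incFle.
  rewrite in_itv/= => /andP[py yq].
  have FpFq : F (p n) <= F (q n) by exact: incFle.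
  have [|c cpq <-] := @IVT R F (p n) (q n) y (pq n) (withinF n).
    by rewrite (min_idPl FpFq) (max_idPr FpFq) py.
  by exists c.
have derF n : derivable_oo_LRcontinuous F (p n) (q n).
  split => [x|//|//].
  - by move=> /(subset_itv_oo_cc)/segD/dF[].
  - exact/cvg_at_right_filter/cF.
  - exact/cvg_at_left_filter/cF.
have GF y n : y \in `[F (p n), F (q n)] -> {for y, continuous G} /\ 0 <= G y.
  move=> ypq; have : (F @` `[p n, q n]) y by rewrite imF.
  by move=> [x /segD Dx <-]; split; [exact: cG|exact: G0].
have step n : (\int[lebesgue_measure]_(x in `[F (p n), F (q n)]) (G x)%:E =
    \int[lebesgue_measure]_(x in `[p n, q n]) (G (F x) * f x)%:E)%E.
  rewrite integration_by_substitution_increasing//.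
  - apply: eq_integral => x; rewrite inE/= => /segD Dx.
    by rewrite -(F'E x Dx).
  - by move=> x y /segD Dx /segD Dy; apply: incF; rewrite inE.
  - by move=> x /subset_itv_oo_cc /segD; exact: cF'.
  - by apply/cvg_ex; exists (derive1 F (p n)); apply: cvg_at_right_filter; exact: cF'.
  - by apply/cvg_ex; exists (derive1 F (q n)); apply: cvg_at_left_filter; exact: cF'.
  - by apply: continuous_in_subspaceT => y; rewrite inE/= => /GF[].
have nd1 : nondecreasing_seq (fun n => `[p n, q n]%classic : set R).
  move=> m n mn; rewrite subsetEset; apply: subset_itv.
  by rewrite bnd_simp pN.
  by rewrite bnd_simp qN.
have nd2 : nondecreasing_seq (fun n => `[F (p n), F (q n)]%classic : set R).
  move=> m n mn; rewrite subsetEset -!imF; apply: image_subset.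
  by rewrite -subsetEset; exact: nd1.
have -> : F @` D = \bigcup_n `[F (p n), F (q n)]%classic.
  by rewrite DE image_bigcup; apply: eq_bigcupr => n _; rewrite imF.
have := @ge0_nondecreasing_set_cvg_integral _ (measurableTypeR R) R _ (EFin \o G)
  lebesgue_measure nd2.
have := @ge0_nondecreasing_set_cvg_integral _ (measurableTypeR R) R _ 
  (fun x => (G (F x) * f x)%:E) lebesgue_measure nd1.
rewrite -DE => h1 h2.
have iD : interior D = D by apply/interior_id.
(* Monotone convergence asks for a nonnegative integrand; the derivative of an increasing function
   is one. *)
have f0 x : D x -> 0 <= f x.
  move=> Dx; rewrite -F'E//; apply: (@incr_derive1_ge0 _ _ D) => //.
    by move=> z; rewrite inE iD => /dF[].
  by rewrite iD.
have {}h1 := h1 (fun=> measurable_itv _).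
have {}h2 := h2 (fun=> measurable_itv _).
have {}h2 : (\int[lebesgue_measure]_(x in `[F (p i), F (q i)]) (EFin \o G) x)%E @[i --> \oo] -->
  (\int[lebesgue_measure]_(x in \bigcup_i `[F (p i), F (q i)]%classic) (EFin \o G) x)%E.
  apply: h2 => [n|n x /GF[_ ?]]; last by rewrite lee_fin.
  apply/measurable_EFinP; apply: subspace_continuous_measurable_fun => //.
  by apply: continuous_in_subspaceT => y; rewrite inE/= => /GF[].
have {}h1 : (\int[lebesgue_measure]_(x in `[p i, q i]) (G (F x) * f x)%:E)%E @[i --> \oo] -->
  (\int[lebesgue_measure]_(x in D) (G (F x) * f x)%:E)%E.
  apply: h1 => [n|n x /segD Dx]; last by rewrite lee_fin mulr_ge0 ?G0 ?f0.
  apply/measurable_EFinP; apply: subspace_continuous_measurable_fun => //.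
  apply: continuous_in_subspaceT => y; rewrite inE/= => /segD Dy.
  apply: cvgM; last exact: cf.
  by apply: continuous_comp; [exact: cF|exact: cG].
have E : (fun i => \int[lebesgue_measure]_(x in `[p i, q i]) (G (F x) * f x)%:E)%E =
    (fun i => \int[lebesgue_measure]_(x in `[F (p i), F (q i)]) (EFin \o G) x)%E.
  by apply/funext => i; rewrite -step.
by rewrite E in h1; exact: (cvg_unique _ h2 h1).
Qed.

Lemma segment_exhausted_oo (R : realType) (b : R) :
  0 < b -> segment_exhausted `]0, b[%classic.
Proof.
move=> b0; split; first exact: interval_open.
(* The shift by 2 gives [e n <= b / 2], so that the endpoints [e n] and [b - e n] are in order from
   [n = 0] on. *)
pose e n : R := b / n.+2%:R.
have eN m n : (m <= n)%N -> e n <= e m.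
  move=> mn; rewrite ler_pM2l// lef_pV2 ?posrE ?ltr0n//.
  by rewrite ler_nat !ltnS.
exists e, (fun n => b - e n); split.
- exact: eN.
- by move=> m n mn; rewrite lerB// eN.
- move=> n; rewrite lerBrDr -mulrDr -[leRHS]mulr1 ler_pM2l//.
  rewrite -mulr2n -[_ *+ 2]mulr_natl ler_pdivrMr ?ltr0n// mul1r.
  by rewrite ler_nat.
- apply/seteqP; split => [x|x [n _]]/=; rewrite !in_itv/=.
    move=> /andP[x0 xb].
    have m0 : 0 < Num.min x (b - x) by rewrite lt_min x0 subr_gt0.
    pose n := Num.truncn (b / Num.min x (b - x)).
    have en : e n <= Num.min x (b - x).
      rewrite ler_pdivrMr ?ltr0n// mulrC -ler_pdivrMr//.
      rewrite ltW// (lt_le_trans (truncnS_gt _))//.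
      by rewrite ler_nat.
    exists n => //=; rewrite in_itv/=.
    by move: en; rewrite le_min => /andP[-> h]; rewrite lerBrDl -lerBrDr.
  have e0 : 0 < e n by rewrite divr_gt0.
  move=> /andP[ex xe]; rewrite (lt_le_trans e0 ex)/=.
  by rewrite (le_lt_trans xe)// ltrBlDr ltrDl.
Qed.

Lemma segment_exhausted_oy (R : realType) :
  segment_exhausted (`]0, +oo[%classic : set R).
Proof.
split; first exact: interval_open.
exists (fun n => n.+1%:R^-1), (fun n => n.+1%:R); split.
- by move=> m n mn; rewrite lef_pV2 ?posrE ?ltr0n// ler_nat.
- by move=> m n mn; rewrite ler_nat.
- by move=> n; rewrite (@le_trans _ _ 1)// ?invf_le1 ?ltr0n ?ler1n.
- apply/seteqP; split => [x|x [n _]]/=; rewrite !in_itv/= ?andbT.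
    move=> x0; exists (maxn (Num.truncn x) (Num.truncn x^-1)) => //=.
    rewrite in_itv/=; apply/andP; split.
      rewrite invf_ple ?posrE ?ltr0n// ltW// (lt_le_trans (truncnS_gt _))//.
      by rewrite ler_nat ltnS leq_maxr.
    rewrite ltW// (lt_le_trans (truncnS_gt _))//.
    by rewrite ler_nat ltnS leq_maxl.
  by move=> /andP[nx _]; rewrite (lt_le_trans _ nx)// invr_gt0 ltr0n.
Qed.

(** * Real powers: continuity, images of intervals, first integrals *)

Lemma continuous_powR (R : realType) (r x : R) :
  0 < x -> {for x, continuous (fun t : R => t `^ r)}.
Proof.
move=> x0; apply/differentiable_continuous/derivable1_diffP.
by apply: derivable_powR; rewrite in_itv/= x0.
Qed.

Lemma continuous_powRB (R : realType) (r z x : R) :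
  x < z -> {for x, continuous (fun t : R => (z - t) `^ r)}.
Proof.
move=> xz; apply: (@continuous_comp _ _ _ (fun t : R => z - t) (fun u => u `^ r)).
  by apply: cvgB; [exact: cvg_cst|exact: cvg_id].
by apply: continuous_powR; rewrite subr_gt0.
Qed.

Lemma continuous_expRN (R : realType) (x : R) :
  {for x, continuous (fun t : R => expR (- t))}.
Proof.
by apply: continuous_comp; [exact: opp_continuous|exact: continuous_expR].
Qed.

Lemma ltr_powR_oy (R : realType) (r : R) :
  0 < r -> {in `]0, +oo[%classic &, {homo (fun x : R => x `^ r) : x y / x < y}}.
Proof.
move=> r0 x y; rewrite !inE/= !in_itv/= !andbT => x0 y0.
by apply: gt0_ltr_powR => //; rewrite nnegrE ltW.
Qed.

Lemma powR_image (R : realType) (r b : R) : 0 < r -> 0 < b ->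
  (fun x : R => x `^ r) @` `]0, b[%classic = `]0, b `^ r[%classic.
Proof.
move=> r0 b0; apply/seteqP; split => [_ [x + <-]|y]/=; rewrite !in_itv/=.
  move=> /andP[x0 xb]; rewrite powR_gt0//=.
  by apply: gt0_ltr_powR => //; rewrite nnegrE ltW.
move=> /andP[y0 yb]; exists (y `^ r^-1); last first.
  by rewrite -powRrM mulVf ?gt_eqF// powRr1// ltW.
rewrite in_itv/= powR_gt0//=.
rewrite -[ltRHS](@powRr1 _ b) ?ltW// -(@mulfV _ r) ?gt_eqF// powRrM.
by apply: gt0_ltr_powR; rewrite ?invr_gt0// nnegrE ltW// powR_gt0.
Qed.

(** The change of variables with [G = 1]. It serves as a fundamental theorem of calculus for
    improper integrals: the total increase of [F] is read off as the length of its image. *)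
Lemma integral_derive_image (R : realType) (D : set R) (F f : R -> R) :
  segment_exhausted D -> measurable (F @` D) ->
  {in D &, {homo F : x y / x < y}} ->
  (forall x, D x -> is_derive x 1 F (f x)) ->
  (forall x, D x -> {for x, continuous f}) ->
  (\int[mu]_(x in D) (f x)%:E = mu (F @` D))%E.
Proof.
move=> Dexh mFD incF dF cf.
have mD : measurable D by case: Dexh => /open_measurable.
have cst1 x : D x -> {for F x, continuous (fun=> 1 : R)} by move=> _; exact: cvg_cst.
have := ge0_integral_image Dexh incF dF cf cst1 (fun _ _ => ler01).
under [in X in _ = X -> _]eq_integral do rewrite mul1r.
by move=> <-; rewrite integral_cst// mul1e.
Qed.

Lemma integral_powR01 (R : realType) (s : R) : 0 < s ->
  (\int[mu]_(v in `]0%R, 1%R[) (v `^ (s - 1))%:E = (s^-1)%:E)%E.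
Proof.
move=> s0.
have Dexh := @segment_exhausted_oo R 1 ltr01.
have sub x : (`]0, 1[%classic : set R) x -> 0 < x by rewrite /= in_itv/= => /andP[].
have : (\int[mu]_(v in `]0%R, 1%R[) (s * v `^ (s - 1))%:E = 1)%E.
  have im : (fun x : R => x `^ s) @` `]0, 1[%classic = `]0, 1[%classic.
    by rewrite powR_image// powR1.
  transitivity (mu ((fun x : R => x `^ s) @` `]0, 1[%classic)); last first.
    by rewrite im lebesgue_measure_itv/= lte_fin ltr01 sube0.
  apply: integral_derive_image => //.
  - by rewrite im.
  - move=> x y; rewrite !inE => /sub x0 /sub y0; apply: ltr_powR_oy => //.
      by rewrite inE/= in_itv/= x0.
    by rewrite inE/= in_itv/= y0.
  - by move=> x /sub; exact: is_derive1_powR.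
  - move=> x /sub x0; apply: cvgM; first exact: cvg_cst.
    exact: continuous_powR.
under eq_integral do rewrite EFinM.
rewrite ge0_integralZl//; last 3 first.
- by apply/measurable_EFinP; apply: measurable_funTS; exact: measurable_powR.
- by move=> x _; rewrite lee_fin powR_ge0.
- by rewrite lee_fin ltW.
move=> /(congr1 (mule (s^-1)%:E)).
by rewrite muleA -EFinM mulVf ?gt_eqF// mul1e mule1.
Qed.

(** * The Gamma function and the Beta integral *)

Lemma measurable_Gamma_integrand (R : realType) (s : R) :
  measurable_fun setT (fun t : R => t `^ (s - 1) * expR (- t)).
Proof.
apply: measurable_funM; first exact: measurable_powR.
by apply: measurableT_comp => //; exact: measurable_expR.
Qed.

(** For t <= 1 the factors are at most 1 and 4. For t >= 1 the square is at most 4 t^(2s) <= 4 t^n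
    for an integer n >= 2s, and e^t >= t^n / n!. *)
Lemma expRN_powR_bounded (R : realType) (s : R) : 0 < s ->
  exists2 K, 0 < K & forall t : R, 0 < t -> expR (- t) * (1 + t `^ s) ^+ 2 <= K.
Proof.
move=> s0; pose n := (Num.truncn (2 * s)).+1.
have ns : 2 * s <= n%:R by rewrite ltW// truncnS_gt.
have f1 : 1 <= n`!%:R :> R by rewrite ler1n fact_gt0.
exists (4 * n`!%:R); first by rewrite mulr_gt0// ltr0n fact_gt0.
have p1 : (1 : R) `^ s = 1 by rewrite powR1.
move=> t t0; have [t1|t1] := leP t 1.
  have ts : t `^ s <= 1.
    by rewrite -[leRHS]p1; apply: ge0_ler_powR; rewrite ?nnegrE// ltW.
  have h1 : (1 + t `^ s) ^+ 2 <= 4.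
    by have := powR_ge0 t s; nra.
  have h2 : expR (- t) <= 1 by rewrite -expR0 ler_expR oppr_le0 ltW.
  have := expR_gt0 (- t); have := sqr_ge0 (1 + t `^ s); nra.
have ts : 1 <= t `^ s.
  by rewrite -[leLHS]p1; apply: ge0_ler_powR; rewrite ?nnegrE// ltW.
rewrite expRN mulrC ler_pdivrMr ?expR_gt0//.
apply: (@le_trans _ _ (4 * t ^+ n)).
  apply: (@le_trans _ _ (4 * (t `^ s) ^+ 2)); first by nra.
  rewrite ler_pM2l//; rewrite -powR_mulrn ?powR_ge0// -powRrM mulrC.
  by rewrite -powR_mulrn ?(ltW t0)// ler_powR// ltW.
rewrite -mulrA ler_pM2l// mulrC -ler_pdivrMr ?ltr0n ?fact_gt0//.
by apply: le_trans (expR_ge1Dxn n.-1 (ltW t0)); rewrite lerDr.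
Qed.

(* The integrand is dominated by a multiple of the derivative of
   1 - 1 / (1 + t^s), which increases from 0 to 1 on the half-line. *)
Lemma Gamma_integral_lty (R : realType) (s : R) : 0 < s ->
  (\int[mu]_(t in `]0%R, +oo[) (t `^ (s - 1) * expR (- t))%:E < +oo)%E.
Proof.
move=> s0; have [K K0 tK] := expRN_powR_bounded s0.
have sub x : (`]0, +oo[%classic : set R) x -> 0 < x.
  by rewrite /= in_itv/= andbT.
pose F (t : R) := 1 - (1 + t `^ s)^-1.
pose f (t : R) := s * t `^ (s - 1) / (1 + t `^ s) ^+ 2.
have p0 (t : R) : 0 < 1 + t `^ s by rewrite ltr_pwDl// powR_ge0.
have im : F @` `]0, +oo[%classic = `]0, 1[%classic.
  apply/seteqP; split => [_ [x /sub x0 <-]|y]/=; rewrite !in_itv/=.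
    have : 1 < 1 + x `^ s by rewrite ltrDl powR_gt0.
    by rewrite /F subr_gt0 invf_lt1// => ->/=; rewrite ltrBlDr ltrDl invr_gt0.
  move=> /andP[y0 y1]; have y1' : 0 < 1 - y by rewrite subr_gt0.
  (* Solving 1 - 1 / (1 + x^s) = y gives x^s = y / (1 - y). *)
  exists ((y / (1 - y)) `^ s^-1).
    by rewrite /= in_itv/= andbT powR_gt0// divr_gt0.
  rewrite /F -powRrM mulVf ?gt_eqF// powRr1; last by rewrite divr_ge0 ?ltW.
  by field; rewrite ?gt_eqF//=; lra.
have cf (x : R) : 0 < x -> {for x, continuous f}.
  move=> x0; apply: cvgM.
    by apply: cvgM; [exact: cvg_cst|exact: continuous_powR].
  apply: cvgV; first by rewrite expf_neq0// gt_eqF.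
  apply: (@continuous_comp _ _ _ (fun t : R => 1 + t `^ s) (fun u => u ^+ 2)).
    by apply: cvgD; [exact: cvg_cst|exact: continuous_powR].
  exact: exprn_continuous.
have mf : measurable_fun (`]0, +oo[%classic : set R) (EFin \o f).
  apply/measurable_EFinP; apply: open_continuous_measurable_fun.
    exact: interval_open.
  by move=> x; rewrite inE => /sub; exact: cf.
have intf : (\int[mu]_(t in `]0%R, +oo[) (f t)%:E = 1)%E.
  transitivity (mu (F @` `]0, +oo[%classic)); last first.
    by rewrite im lebesgue_measure_itv/= lte_fin ltr01 sube0.
  apply: integral_derive_image.
  - exact: segment_exhausted_oy.
  - by rewrite im.
  - move=> x y xD yD xy; rewrite /F ltrD2l ltrN2 ltf_pV2 ?posrE// ltrD2l.
    exact: ltr_powR_oy.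
  - move=> x /sub x0.
    have dp := is_derive1_powR s x0.
    have dq : is_derive x 1 (fun t : R => 1 + t `^ s) (s * x `^ (s - 1)).
      by rewrite -[X in is_derive _ _ _ X]add0r; exact: is_deriveD.
    have dV := @is_deriveV R (fun t : R => 1 + t `^ s) x _ 1 (lt0r_neq0 (p0 x)) dq.
    apply: is_derive_eq (is_deriveB (is_derive_cst (1 : R) x 1) dV) _.
    by rewrite /f sub0r /GRing.scale/=; field; rewrite gt_eqF.
  - by move=> x /sub; exact: cf.
apply: (@le_lt_trans _ _ (\int[mu]_(t in `]0%R, +oo[) ((K / s)%:E * (f t)%:E))%E).
  apply: ge0_le_integral => //.
  - by move=> t _; rewrite lee_fin mulr_ge0 ?powR_ge0 ?expR_ge0.
  - apply/measurable_EFinP; apply: measurable_funTS.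
    exact: measurable_Gamma_integrand.
  - exact: measurable_funeM.
  - move=> t /sub t0; rewrite -EFinM lee_fin.
    have -> : K / s * f t = t `^ (s - 1) * (K / (1 + t `^ s) ^+ 2).
      by rewrite /f; field; rewrite !gt_eqF.
    by rewrite ler_pM2l ?powR_gt0// ler_pdivlMr ?exprn_gt0// tK.
rewrite ge0_integralZl//; last 2 first.
- move=> t /sub t0; rewrite lee_fin /f.
  by rewrite !mulr_ge0 ?powR_ge0 ?invr_ge0 ?exprn_ge0 ?(ltW s0)// ltW.
- by rewrite lee_fin divr_ge0 ?ltW.
by rewrite intf mule1 ltry.
Qed.

Lemma Gamma_integrand_ge0 (R : realType) (s t : R) :
  0 <= t `^ (s - 1) * expR (- t).
Proof. by rewrite mulr_ge0 ?powR_ge0 ?expR_ge0. Qed.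

Lemma Gamma_integralE (R : realType) (s : R) : 0 < s ->
  (\int[mu]_(t in `]0%R, +oo[) (t `^ (s - 1) * expR (- t))%:E = (Gamma s)%:E)%E.
Proof.
move=> s0; rewrite /Gamma /Rintegral fineK// ge0_fin_numE ?Gamma_integral_lty//.
by apply: integral_ge0 => t _; rewrite lee_fin Gamma_integrand_ge0.
Qed.

(** Keep only the part of the integral over ]M, M + 1[ and bound t^(s-1) = t^s / t from below by M^s
    / (M + 1). Taking M = 1 gives positivity and a uniform lower bound; a large M makes Gamma
    outgrow any geometric sequence. *)
Lemma Gamma_ge (R : realType) (s M : R) : 0 < s -> 0 < M ->
  M `^ s * expR (- (M + 1)) / (M + 1) <= Gamma s.
Proof.
move=> s0 M0; rewrite -lee_fin -Gamma_integralE//.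
have M10 : 0 < M + 1 by lra.
pose c := M `^ s * expR (- (M + 1)) / (M + 1).
have mf D : measurable_fun D (fun t : R => (t `^ (s - 1) * expR (- t))%:E).
  apply/measurable_EFinP; apply: measurable_funTS.
  exact: measurable_Gamma_integrand.
apply: (@le_trans _ _ (\int[mu]_(t in `]M, (M + 1)%R[) (c%:E))%E).
  rewrite integral_cst//= lebesgue_measure_itv/= lte_fin ltrDl ltr01.
  by rewrite -EFinB addrAC subrr add0r mule1.
apply: (@le_trans _ _ (\int[mu]_(t in `]M, (M + 1)%R[) (t `^ (s - 1) * expR (- t))%:E)%E).
  apply: ge0_le_integral => //.
  - by move=> t _; rewrite lee_fin !mulr_ge0 ?powR_ge0 ?expR_ge0// invr_ge0 ltW.
  - exact: mf.
  - move=> t /=; rewrite in_itv/= => /andP[Mt tM].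
    have t0 : 0 < t by exact: lt_trans Mt.
    rewrite lee_fin /c powRB; last by rewrite (gt_eqF t0) implybT.
    rewrite powRr1; last exact: ltW.
    rewrite mulrAC ler_pM ?expR_ge0//.
    + by rewrite divr_ge0 ?powR_ge0 ?ltW.
    + rewrite ler_pM ?powR_ge0 ?invr_ge0 ?(ltW M10)//.
        by apply: ge0_ler_powR; rewrite ?nnegrE ?ltW.
      by rewrite lef_pV2 ?posrE// ltW.
    + by rewrite ler_expR lerN2 ltW.
apply: ge0_subset_integral => //; first exact: mf.
  by move=> t _; rewrite lee_fin Gamma_integrand_ge0.
by move=> t /=; rewrite !in_itv/= andbT => /andP[Mt _]; exact: lt_trans Mt.
Qed.

Lemma Gamma_gt0 (R : realType) (s : R) : 0 < s -> 0 < Gamma s.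
Proof.
move=> s0; apply: lt_le_trans (Gamma_ge s0 ltr01).
by rewrite divr_gt0// mulr_gt0 ?powR_gt0 ?expR_gt0.
Qed.

Lemma Gamma1 (R : realType) : Gamma (1 : R) = 1.
Proof.
apply: EFin_inj; rewrite -Gamma_integralE//.
pose F (t : R) := 1 - expR (- t).
have im : F @` `]0, +oo[%classic = `]0, 1[%classic.
  apply/seteqP; split => [_ [x + <-]|y]/=; rewrite !in_itv/= ?andbT.
    rewrite in_itv/= andbT => x0.
    by rewrite subr_gt0 expR_lt1 oppr_lt0 x0 ltrBlDr ltrDl expR_gt0.
  move=> /andP[y0 y1]; have y1' : 0 < 1 - y by rewrite subr_gt0.
  exists (- ln (1 - y)).
    by rewrite /= in_itv/= andbT oppr_gt0 ln_lt0// y1' gtrDl oppr_lt0.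
  by rewrite /F opprK lnK ?posrE// subKr.
transitivity (mu (F @` `]0, +oo[%classic)); last first.
  by rewrite im lebesgue_measure_itv/= lte_fin ltr01 sube0.
transitivity (\int[mu]_(t in `]0%R, +oo[) (expR (- t : R))%:E)%E.
  by apply: eq_integral => t _; rewrite subrr powRr0 mul1r.
apply: integral_derive_image.
- exact: segment_exhausted_oy.
- by rewrite im.
- by move=> x y _ _ xy; rewrite /F ltrD2l ltrN2 ltr_expR ltrN2.
- move=> x _; apply: is_derive_eq.
  by rewrite add0r mul1r mulrN1 opprK.
- by move=> x _; exact: continuous_expRN.
Qed.

Lemma translation_image_oy (R : realType) (v : R) :
  (fun t => t + v) @` `]0, +oo[%classic = `]v, +oo[%classic.
Proof.
apply/seteqP; split => [_ [x + <-]|y]/=; rewrite !in_itv/= !andbT.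
  by rewrite in_itv/= andbT ltrDr.
by move=> vy; exists (y - v); rewrite ?subrK//= in_itv/= subr_gt0 vy.
Qed.

Lemma scaling_image_oo (R : realType) (z : R) : 0 < z ->
  (fun t => z * t) @` `]0, 1[%classic = `]0, z[%classic.
Proof.
move=> z0; apply/seteqP; split => [_ [x + <-]|y]/=; rewrite !in_itv/=.
  by rewrite in_itv/= => /andP[x0 x1]; rewrite mulr_gt0//= gtr_pMr.
move=> /andP[y0 yz]; exists (y / z); last by rewrite mulrC divfK ?gt_eqF.
by rewrite /= in_itv/= divr_gt0//= ltr_pdivrMr// mul1r.
Qed.

(* Convolution kernel whose integral over ]0, z[ is z^(s+b-1) B(s,b). *)
Definition beta_kernel (R : realType) (s b z v : R) : R :=
  v `^ (s - 1) * (z - v) `^ (b - 1).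

Lemma beta_kernel_ge0 (R : realType) (s b z v : R) : 0 <= beta_kernel s b z v.
Proof. by rewrite mulr_ge0 ?powR_ge0. Qed.

Lemma continuous_beta_kernel (R : realType) (s b z v : R) : 0 < v -> v < z ->
  {for v, continuous (beta_kernel s b z)}.
Proof.
by move=> v0 vz; apply: cvgM; [exact: continuous_powR|exact: continuous_powRB].
Qed.

Lemma beta_integral_scale (R : realType) (s b z : R) : 0 < z ->
  (\int[mu]_(v in `]0%R, z[) (beta_kernel s b z v)%:E =
   (z `^ (s + b - 1))%:E * \int[mu]_(v in `]0%R, 1%R[) (beta_kernel s b 1 v)%:E)%E.
Proof.
move=> z0.
have sub x : (`]0, 1[%classic : set R) x -> 0 < x /\ x < 1.
  by rewrite /= in_itv/= => /andP[].
rewrite -(scaling_image_oo z0).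
transitivity (\int[mu]_(t in `]0%R, 1%R[) (beta_kernel s b z (z * t) * z)%:E)%E.
  apply: (@ge0_integral_image R _ (fun t => z * t) (fun=> z)).
  - exact: segment_exhausted_oo.
  - by move=> x y _ _ xy; rewrite ltr_pM2l.
  - move=> x _; apply: is_derive_eq.
    exact: mulr1.
  - by move=> x _; exact: cvg_cst.
  - move=> x /sub[x0 x1]; apply: continuous_beta_kernel.
      by rewrite mulr_gt0.
    by rewrite gtr_pMr.
  - by move=> x _; exact: beta_kernel_ge0.
rewrite -ge0_integralZl//; last 3 first.
- apply/measurable_EFinP; apply: open_continuous_measurable_fun.
    exact: interval_open.
  by move=> x; rewrite inE => /sub[x0 x1]; exact: continuous_beta_kernel.
- by move=> x _; rewrite lee_fin beta_kernel_ge0.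
- by rewrite lee_fin powR_ge0.
apply: eq_integral => t; rewrite inE => /sub[t0 t1].
rewrite -EFinM /beta_kernel -{2}(mulr1 z) -mulrBr !powRM ?ltW ?subr_gt0//.
have -> : s + b - 1 = (s - 1) + (b - 1) + 1 by ring.
have zD r1 r2 : z `^ (r1 + r2) = z `^ r1 * z `^ r2.
  by rewrite powRD// (gt_eqF z0) implybT.
rewrite (zD _ 1) (zD (s - 1)) powRr1; last exact: ltW.
by congr EFin; ring.
Qed.

(** The integrand is extended by 0 off the region 0 < v < z, which puts Tonelli on the whole
    plane. *)
Lemma measurable_beta_convolution (R : realType) (s b : R) :
  measurable_fun setT (fun p : R * R =>
    (if (0 < p.1) && (p.1 < p.2) then beta_kernel s b p.2 p.1 * expR (- p.2)
     else 0)).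
Proof.
have m1 : measurable_fun setT (fst : R * R -> R) by exact: measurable_fst.
have m2 : measurable_fun setT (snd : R * R -> R) by exact: measurable_snd.
apply: measurable_fun_if => //.
- apply: measurable_and; apply: measurable_fun_ltr => //.
- apply: measurable_funTS; apply: measurable_funM; last first.
    apply: measurableT_comp; first exact: measurable_expR.
    exact: measurableT_comp.
  apply: measurable_funM.
    by apply: (measurableT_comp (measurable_powR _)).
  apply: (measurableT_comp (measurable_powR _)).
  exact: measurable_funB.
Qed.

(* Tonelli on {0 < v < z} for v^(s-1) (z-v)^(b-1) e^(-z): integrating in z first
   gives Gamma s * Gamma b, in v first gives B(s,b) * Gamma (s + b). *)
Lemma beta_integral_Gamma (R : realType) (s b : R) : 0 < s -> 0 < b ->
  (\int[mu]_(v in `]0%R, 1%R[) (beta_kernel s b 1 v)%:E =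
   (Gamma s * Gamma b / Gamma (s + b))%:E)%E.
Proof.
move=> s0 b0.
pose h (p : R * R) : R :=
  if (0 < p.1) && (p.1 < p.2) then beta_kernel s b p.2 p.1 * expR (- p.2) else 0.
have h0 p : 0 <= h p.
  by rewrite /h; case: ifP => // _; rewrite mulr_ge0 ?beta_kernel_ge0 ?expR_ge0.
have mh : measurable_fun setT h by exact: measurable_beta_convolution.
have mG r : measurable_fun (`]0, +oo[%classic : set R)
    (fun t : R => (t `^ (r - 1) * expR (- t))%:E).
  apply/measurable_EFinP; apply: measurable_funTS.
  exact: measurable_Gamma_integrand.
have E : (\int[mu]_v \int[mu]_z (h (v, z))%:E =
            \int[mu]_z \int[mu]_v (h (v, z))%:E)%E.
  apply: (@fubini_tonelli _ _ _ _ R mu mu (EFin \o h)); first exact/measurable_EFinP.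
  by move=> p; rewrite lee_fin.
have Ev (v : R) : (\int[mu]_z (h (v, z))%:E =
    ((fun v => (v `^ (s - 1) * expR (- v))%:E * (Gamma b)%:E) \_ `]0%R, +oo[) v)%E.
  rewrite patchE; case: ifPn; rewrite ?inE ?notin_setE /= in_itv/= andbT => v0; last first.
    have {}v0 : (0 < v) = false by exact/negP.
    by apply: integral0_eq => z _; rewrite /h/= v0.
  transitivity (\int[mu]_(z in `]v, +oo[) (beta_kernel s b z v * expR (- z))%:E)%E.
    rewrite [RHS]integral_mkcond; apply: eq_integral => z _.
    rewrite patchE /h/= v0/= mem_setE in_itv/= andbT.
    by case: ifPn.
  rewrite -(translation_image_oy v).
  (* With z = t + v the exponential splits as e^(-t) e^(-v), and the inner integral becomes the one
     defining [Gamma b]. *)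
  transitivity (\int[mu]_(t in `]0%R, +oo[)
      (beta_kernel s b (t + v) v * expR (- (t + v)) * 1)%:E)%E.
    apply: (@ge0_integral_image R _ (fun t => t + v) (fun=> 1)
        (fun z => beta_kernel s b z v * expR (- z))).
    - exact: segment_exhausted_oy.
    - by move=> x y _ _ xy; rewrite ltrD2r.
    - by move=> x _; apply: is_derive_eq; exact: addr0.
    - by move=> x _; exact: cvg_cst.
    - move=> x; rewrite /= in_itv/= andbT => x0; apply: cvgM; last exact: continuous_expRN.
      apply: cvgM; first exact: cvg_cst.
      apply: (@continuous_comp _ _ _ (fun z : R => z - v) (fun u => u `^ (b - 1))).
        by apply: cvgB; [exact: cvg_id|exact: cvg_cst].
      by apply: continuous_powR; rewrite addrK.
    - by move=> x _; rewrite mulr_ge0 ?beta_kernel_ge0 ?expR_ge0.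
  rewrite -(Gamma_integralE b0).
  rewrite -ge0_integralZl; last 4 first.
  - exact: measurable_itv.
  - exact: mG.
  - by move=> t _; rewrite lee_fin Gamma_integrand_ge0.
  - by rewrite lee_fin Gamma_integrand_ge0.
  apply: eq_integral => t _; rewrite -EFinM; congr EFin.
  by rewrite /beta_kernel addrK opprD expRD; ring.
have Ez (z : R) : (\int[mu]_v (h (v, z))%:E =
    ((fun z => (z `^ (s + b - 1) * expR (- z))%:E *
     \int[mu]_(v in `]0%R, 1%R[) (beta_kernel s b 1 v)%:E) \_ `]0%R, +oo[) z)%E.
  rewrite patchE; case: ifPn; rewrite ?inE ?notin_setE /= in_itv/= andbT => z0; last first.
    apply: integral0_eq => v _; rewrite /h/=.
    suff -> : (0 < v) && (v < z) = false by [].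
    by apply/negP => /andP[v0 vz]; case: z0; exact: lt_trans vz.
  transitivity (\int[mu]_(v in `]0%R, z[) ((expR (- z))%:E * (beta_kernel s b z v)%:E))%E.
    rewrite [RHS]integral_mkcond; apply: eq_integral => v _.
    rewrite patchE /h/= mem_setE in_itv/=; case: ifPn => _; last by [].
    by rewrite -EFinM mulrC.
  rewrite ge0_integralZl; last 4 first.
  - exact: measurable_itv.
  - apply/measurable_EFinP; apply: open_continuous_measurable_fun.
      exact: interval_open.
    move=> x; rewrite inE/= in_itv/= => /andP[x0 xz].
    exact: continuous_beta_kernel.
  - by move=> x _; rewrite lee_fin beta_kernel_ge0.
  - by rewrite lee_fin expR_ge0.
  by rewrite beta_integral_scale; [rewrite muleA -EFinM mulrC|].
move: E; under eq_integral do rewrite Ev.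
under [in X in _ = X -> _]eq_integral do rewrite Ez.
rewrite -!integral_mkcond ge0_integralZr; last 4 first.
- exact: measurable_itv.
- exact: mG.
- by move=> t _; rewrite lee_fin Gamma_integrand_ge0.
- by rewrite lee_fin ltW// Gamma_gt0.
rewrite ge0_integralZr; last 4 first.
- exact: measurable_itv.
- exact: mG.
- by move=> t _; rewrite lee_fin Gamma_integrand_ge0.
- by apply: integral_ge0 => v _; rewrite lee_fin beta_kernel_ge0.
have G0 : 0 < Gamma (s + b) by rewrite Gamma_gt0// addr_gt0.
rewrite (Gamma_integralE s0) (Gamma_integralE (addr_gt0 s0 b0)).
move: (integral _ _ _) => I E.
(* Here [E] says that Gamma s Gamma b equals Gamma (s + b) times [I]. As [I] is an extended real,
   the division is done by inserting the finite factor Gamma (s + b)^-1 Gamma (s + b). *)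
rewrite -[I]mul1e -(mulVf (lt0r_neq0 G0)) EFinM -muleA -E -!EFinM.
by congr EFin; rewrite mulrC.
Qed.

(** The Beta integral with b = 1 is the integral of v^(s-1), that is 1/s; this replaces integration
    by parts. *)
Lemma GammaS (R : realType) (s : R) : 0 < s -> Gamma (s + 1) = s * Gamma s.
Proof.
move=> s0; have := beta_integral_Gamma s0 ltr01; rewrite Gamma1 mulr1.
under eq_integral do rewrite /beta_kernel subrr powRr0 mulr1.
have G0 : 0 < Gamma (s + 1) by rewrite Gamma_gt0// addr_gt0.
rewrite integral_powR01// => -[/(congr1 (fun z => s * z * Gamma (s + 1)))].
by rewrite mulfV ?gt_eqF// mul1r mulrA divfK ?gt_eqF.
Qed.

Lemma Gamma_addn (R : realType) (s : R) (n : nat) : 0 < s ->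
  Gamma (s + n%:R) = \prod_(i < n) (s + i%:R) * Gamma s.
Proof.
move=> s0; elim: n => [|n IH]; first by rewrite addr0 big_ord0 mul1r.
rewrite -natr1 addrA GammaS; last by rewrite ltr_wpDr.
by rewrite IH big_ord_recr/=; ring.
Qed.

(** Up to the constant [Gamma b] the ratio is a Beta integral, and v^(s-1) decreases in s for v in
    ]0, 1[. It bounds all the multipliers of an operator of positive order by the first one. *)
Lemma Gamma_ratio_antitone (R : realType) (s t b : R) : 0 < s -> s <= t -> 0 < b ->
  Gamma t / Gamma (t + b) <= Gamma s / Gamma (s + b).
Proof.
move=> s0 st b0; have t0 : 0 < t by exact: lt_le_trans st.
rewrite -(ler_pM2r (Gamma_gt0 b0)) mulrAC [leRHS]mulrAC -lee_fin.
rewrite -!beta_integral_Gamma//; apply: ge0_le_integral => //.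
- by move=> v _; rewrite lee_fin beta_kernel_ge0.
- apply/measurable_EFinP; apply: open_continuous_measurable_fun.
    exact: interval_open.
  by move=> x; rewrite inE/= in_itv/= => /andP[x0 x1]; exact: continuous_beta_kernel.
- apply/measurable_EFinP; apply: open_continuous_measurable_fun.
    exact: interval_open.
  by move=> x; rewrite inE/= in_itv/= => /andP[x0 x1]; exact: continuous_beta_kernel.
- move=> v /=; rewrite in_itv/= => /andP[v0 v1].
  rewrite lee_fin ler_wpM2r ?powR_ge0//; apply: ger_powR.
    by rewrite v0 ltW.
  by rewrite lerD2r.
Qed.

(** * Entire coefficient sequences *)

(* Infinite radius of convergence, phrased as Cauchy estimates: boundedness is
   easier to transport than summability. *)
Definition entire (R : realType) (b : nat -> R) : Prop :=
  forall r, 0 < r -> exists M, forall k, `|b k| * r ^+ k <= M.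

(** The estimate at radius 2 (|z| + 1) leaves a geometric majorant of ratio 1/2. *)
Lemma entire_cvg (R : realType) (b : nat -> R) (z : R) :
  entire b -> cvgn (series (fun k => `|b k * z ^+ k|)).
Proof.
move=> eb; have r0 : 0 < 2 * (`|z| + 1) by have := normr_ge0 z; lra.
have [M bM] := eb _ r0.
have z1 : 0 < `|z| + 1 by rewrite ltr_wpDl.
apply: (@series_le_cvg _ _ (geometric M 2^-1)).
- by move=> n.
- move=> n; rewrite /geometric/= mulr_ge0 ?exprn_ge0 ?invr_ge0//.
  by apply: le_trans (bM 0%N); rewrite mulr_ge0.
- move=> n; rewrite /geometric/= exprVn ler_pdivlMr ?exprn_gt0//.
  apply: le_trans (bM n); rewrite normrM normrX -mulrA ler_wpM2l// -exprMn.
  apply: lerXn2r; rewrite ?nnegrE; [by have := normr_ge0 z; lra..|].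
  by have := normr_ge0 z; lra.
- by apply: is_cvg_geometric_series; rewrite ger0_norm ?invf_lt1 ?invr_ge0// ltr1n.
Qed.

Lemma entire_pseries_cvg (R : realType) (b : nat -> R) (z : R) :
  entire b -> cvgn (pseries b z).
Proof. by move=> eb; apply: normed_cvg; exact: entire_cvg. Qed.

(** The geometric factor is absorbed by the estimate for [b] at radius [q * r]. *)
Lemma entireM_geometric (R : realType) (b c : nat -> R) (C q : R) : 0 < q ->
  entire b -> (forall k, `|c k| <= C * q ^+ k) -> entire (fun k => c k * b k).
Proof.
move=> q0 eb cq r r0; have [M bM] := eb (q * r) (mulr_gt0 q0 r0).
have C0 : 0 <= C by have := cq 0%N; rewrite expr0 mulr1; exact: le_trans.
exists (C * M) => k; apply: le_trans (ler_wpM2l C0 (bM k)).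
rewrite exprMn normrM -mulrA.
have -> : C * (`|b k| * (q ^+ k * r ^+ k)) = C * q ^+ k * (`|b k| * r ^+ k) by ring.
by rewrite ler_wpM2r// mulr_ge0// exprn_ge0// ltW.
Qed.

Lemma entireM_bounded (R : realType) (b c : nat -> R) (C : R) :
  entire b -> (forall k, `|c k| <= C) -> entire (fun k => c k * b k).
Proof.
by move=> eb cC; apply: (entireM_geometric ltr01 eb) => k; rewrite expr1n mulr1.
Qed.

(** An affine factor is at most geometric, by k + 1 <= 2^k. Such factors come from x d/dx, whose
    multiplier on the k-th power is affine in k. *)
Lemma entireM_affine (R : realType) (b : nat -> R) (c d : R) :
  entire b -> entire (fun k => (c * k%:R + d) * b k).
Proof.
move=> eb; apply: (@entireM_geometric _ _ _ (`|c| + `|d|) 2) => // k.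
have k2 : k%:R + 1 <= 2 ^+ k :> R.
  by rewrite natr1 -natrX ler_nat; exact: ltn_expl.
apply: le_trans (ler_normD _ _) _; rewrite normrM [`|k%:R|]ger0_norm//.
apply: (@le_trans _ _ ((`|c| + `|d|) * (k%:R + 1))).
  have := normr_ge0 c; have := normr_ge0 d; have := ler0n R k; nra.
by rewrite ler_wpM2l// addr_ge0.
Qed.

Lemma entire_Gamma_inv (R : realType) (a : R) : 0 < a ->
  entire (fun k => (Gamma (a * k%:R + a))^-1).
Proof.
move=> a0 r r0; pose M := r `^ a^-1; have M0 : 0 < M by exact: powR_gt0.
pose C := expR (- (M + 1)) / (M + 1).
have C0 : 0 < C by rewrite divr_gt0 ?expR_gt0 ?addr_gt0.
exists (r * C)^-1 => k.
have s0 : 0 < a * k%:R + a by rewrite ltr_wpDl// mulr_ge0// ltW.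
have G0 := Gamma_gt0 s0.
rewrite ger0_norm ?invr_ge0 ?(ltW G0)// ler_pdivrMl//.
rewrite (ler_pdivlMr _ _ (mulr_gt0 r0 C0)).
apply: le_trans (Gamma_ge s0 M0).
have -> : a * k%:R + a = a * k.+1%:R by rewrite -natr1 mulrDr mulr1.
rewrite /M -powRrM mulrA mulVf ?gt_eqF// mul1r powR_mulrn ?(ltW r0)//.
by rewrite /C !mulrA -exprSr.
Qed.

(** * Generalized power series *)

(* gpower a b w = \sum_k b_k w^(2(a k + a - 1)), factored through a power series. *)
Definition gpower (R : realType) (a : R) (b : nat -> R) (w : R) : R :=
  w `^ (2 * (a - 1)) * limn (pseries b (w `^ (2 * a))).

Lemma sqr_powR (R : realType) (w r : R) : 0 < w -> (w ^+ 2) `^ r = w `^ (2 * r).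
Proof. by move=> w0; rewrite powRrM powR_mulrn// ltW. Qed.

Lemma powR_gt0D (R : realType) (w r t : R) :
  0 < w -> w `^ (r + t) = w `^ r * w `^ t.
Proof. by move=> w0; rewrite powRD// (gt_eqF w0) implybT. Qed.

Lemma powR_gpowerE (R : realType) (a w : R) (k : nat) : 0 < w ->
  w `^ (2 * (a * k%:R + a - 1)) = w `^ (2 * (a - 1)) * (w `^ (2 * a)) ^+ k.
Proof.
move=> w0; rewrite -powR_mulrn ?powR_ge0// -powRrM -powR_gt0D//.
by congr powR; ring.
Qed.

Lemma gpower_cvg (R : realType) (a w : R) (b : nat -> R) : entire b -> 0 < w ->
  series (fun k => b k * w `^ (2 * (a * k%:R + a - 1))) @ \oo --> gpower a b w.
Proof.
move=> eb w0; rewrite /gpower.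
have -> : series (fun k => b k * w `^ (2 * (a * k%:R + a - 1))) =
    (fun n => w `^ (2 * (a - 1)) * pseries b (w `^ (2 * a)) n).
  apply/funext => n; rewrite /pseries /series/= mulr_sumr.
  by apply: eq_bigr => k _; rewrite powR_gpowerE//; ring.
by apply: cvgMl_tmp; exact: entire_pseries_cvg.
Qed.

Lemma gpowerD (R : realType) (a w c d : R) (b1 b2 : nat -> R) :
  entire b1 -> entire b2 -> 0 < w ->
  c * gpower a b1 w + d * gpower a b2 w =
  gpower a (fun k => c * b1 k + d * b2 k) w.
Proof.
move=> e1 e2 w0; rewrite /gpower; set z := _ `^ (2 * a).
have -> : limn (pseries (fun k => c * b1 k + d * b2 k) z) =
    c * limn (pseries b1 z) + d * limn (pseries b2 z).
  apply/cvg_lim => //.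
  have -> : pseries (fun k => c * b1 k + d * b2 k) z =
      (fun n => c * pseries b1 z n + d * pseries b2 z n).
    apply/funext => n; rewrite /pseries /series/= !mulr_sumr -big_split/=.
    by apply: eq_bigr => k _; ring.
  by apply: cvgD; apply: cvgMl_tmp; exact: entire_pseries_cvg.
by ring.
Qed.

Lemma entire_diffs (R : realType) (b : nat -> R) : entire b -> entire (pseries_diffs b).
Proof.
move=> eb r r0; have [M bM] := entireM_affine 1 0 eb r0.
exists (M / r) => k; rewrite ler_pdivlMr// -mulrA -exprSr.
by rewrite /pseries_diffs; have := bM k.+1; rewrite mul1r addr0.
Qed.

(** Multiplying the derived series by z undoes its index shift, so the Euler operator z d/dz acts
    coefficientwise. *)
Lemma pseries_diffs_mulX (R : realType) (b : nat -> R) (z : R) : entire b ->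
  z * limn (pseries (pseries_diffs b) z) = limn (pseries (fun k => k%:R * b k) z).
Proof.
move=> eb; apply/esym/cvg_lim => //.
have := pseries_diffs_equiv (entire_pseries_cvg (z := z) (entire_diffs eb)).
move=> /(cvgMl_tmp (a := z)); apply: cvg_trans; apply: near_eq_cvg; near=> n.
rewrite /pseries /series/= mulr_sumr; apply: eq_bigr => -[|k] _.
  by rewrite !mul0r mulr0.
by rewrite exprS/=; ring.
Unshelve. all: by end_near. Qed.

(** Product and chain rule on the factored form. Stated with w^-1 in front, the derivative shows w
    d/dw as diagonal, each coefficient being multiplied by its exponent 2 (a k + a - 1). *)
Lemma is_derive_gpower (R : realType) (a w : R) (b : nat -> R) : entire b -> 0 < w ->
  is_derive w 1 (gpower a b)
    (w^-1 * gpower a (fun k => (2 * a * k%:R + 2 * (a - 1)) * b k) w).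
Proof.
move=> eb w0; set z := w `^ (2 * a).
have z0 : 0 < z by exact: powR_gt0.
have e1 := entire_diffs eb; have e2 := entire_diffs e1.
have dP : is_derive z (1 : R) (fun x => limn (pseries b x))
    (limn (pseries (pseries_diffs b) z)).
  apply: (@pseries_snd_diffs _ b (z + 1)); try exact: entire_pseries_cvg.
  by rewrite !gtr0_norm// ?addr_gt0// ltrDl.
have d1 := is_derive1_powR (2 * (a - 1)) w0.
have d2 := is_derive1_powR (2 * a) w0.
have d3 := @is_derive1_comp _ _ (fun u => u `^ (2 * a)) _ _ _ dP d2.
apply: is_derive_eq (is_deriveM d1 d3) _.
have ek : entire (fun k => k%:R * b k).
  by have := entireM_affine 1 0 eb; under eq_fun do rewrite mul1r addr0.
have -> : (fun k => (2 * a * k%:R + 2 * (a - 1)) * b k) =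
    (fun k => (2 * a) * (k%:R * b k) + (2 * (a - 1)) * b k).
  by apply/funext => k; ring.
rewrite -gpowerD// /gpower -/z -pseries_diffs_mulX// /GRing.scale/=.
rewrite -/z !(powR_gt0D _ (- 1)) // !powR_inv1 ?ltW// -/z.
by field; rewrite gt_eqF.
Qed.

(** * Erdelyi-Kober operators on generalized power series *)

(** The integrand of [EK_pos] for m = 2 with f split off, which leaves a nonnegative weight. *)
Definition EK_kernel (R : realType) (eta b x u : R) : R :=
  (x `^ 2 - u `^ 2) `^ (b - 1) * u `^ (2 * eta) * (2 * u `^ (2 - 1)).

Lemma EK_kernel_ge0 (R : realType) (eta b x u : R) : 0 <= EK_kernel eta b x u.
Proof. by rewrite !mulr_ge0 ?powR_ge0. Qed.

Lemma measurable_EK_kernel (R : realType) (eta b x : R) :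
  measurable_fun setT (EK_kernel eta b x).
Proof.
apply: measurable_funM; last first.
  by apply: measurable_funM => //; exact: measurable_powR.
apply: measurable_funM; last exact: measurable_powR.
apply: (measurableT_comp (measurable_powR _)).
by apply: measurable_funB => //; exact: measurable_powR.
Qed.

(** The substitution v = u^2 turns the integral into that of [beta_kernel] over ]0, x^2[ with s =
    eta + e + 1. *)
Lemma EK_kernel_power (R : realType) (eta b x e : R) :
  0 < x -> 0 < b -> 0 < eta + e + 1 ->
  (\int[mu]_(u in `]0%R, x[) (EK_kernel eta b x u * u `^ (2 * e))%:E =
   (x `^ (2 * (eta + e + b)) *
     (Gamma (eta + e + 1) * Gamma b / Gamma (eta + e + 1 + b)))%:E)%E.
Proof.
move=> x0 b0 s0; set s := eta + e + 1 in s0 *.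
have x20 : 0 < x `^ 2 by exact: powR_gt0.
have sub u : (`]0, x[%classic : set R) u -> 0 < u /\ u < x.
  by rewrite /= in_itv/= => /andP[].
transitivity (\int[mu]_(v in `]0%R, (x `^ 2)%R[) (beta_kernel s b (x `^ 2) v)%:E)%E; last first.
  rewrite (beta_integral_scale _ _ x20) (beta_integral_Gamma s0 b0) -EFinM.
  by congr (_ * _)%:E; rewrite -powRrM /s; congr powR; ring.
have im := @powR_image R 2 x (ltr0Sn _ 1) x0.
rewrite -im.
transitivity (\int[mu]_(u in `]0%R, x[)
    (beta_kernel s b (x `^ 2) (u `^ 2) * (2 * u `^ (2 - 1)))%:E)%E.
  apply: eq_integral => u; rewrite inE => /sub[u0 ux]; congr EFin.
  rewrite /EK_kernel /beta_kernel -powRrM.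
  have -> : 2 * (s - 1) = 2 * eta + 2 * e by rewrite /s; ring.
  by rewrite (powR_gt0D (2 * eta) (2 * e) u0); ring.
apply/esym; apply: (@ge0_integral_image R _ (fun u => u `^ 2) (fun u => 2 * u `^ (2 - 1))
   (beta_kernel s b (x `^ 2))).
- exact: segment_exhausted_oo.
- move=> u v; rewrite !inE => /sub[u0 _] /sub[v0 _] uv.
  by apply: gt0_ltr_powR => //; rewrite nnegrE ltW.
- by move=> u /sub[u0 _]; exact: is_derive1_powR.
- move=> u /sub[u0 _]; apply: cvgM; first exact: cvg_cst.
  exact: continuous_powR.
- move=> u /sub[u0 ux]; apply: continuous_beta_kernel; first exact: powR_gt0.
  by apply: gt0_ltr_powR => //; rewrite nnegrE ltW.
- by move=> u _; exact: beta_kernel_ge0.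
Qed.

Lemma EK_kernel_power_integrable (R : realType) (eta b x e : R) :
  0 < x -> 0 < b -> 0 < eta + e + 1 ->
  mu.-integrable `]0%R, x[ (fun u => (EK_kernel eta b x u * u `^ (2 * e))%:E).
Proof.
move=> x0 b0 s0; apply/integrableP; split.
  apply/measurable_EFinP; apply: measurable_funTS; apply: measurable_funM.
    exact: measurable_EK_kernel.
  exact: measurable_powR.
under eq_integral.
  move=> u _; rewrite gee0_abs; last by rewrite lee_fin mulr_ge0 ?EK_kernel_ge0 ?powR_ge0.
  over.
by rewrite (EK_kernel_power x0 b0 s0) ltry.
Qed.

(** Termwise integration by dominated convergence. The condition 0 < eta + a makes the Gamma
    argument at k = 0 positive, and those at larger k are no smaller, so every term is integrable at
    0. *)
Lemma EK_pos_gpower (R : realType) (eta b a x : R) (c : nat -> R) (f : R -> R) :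
  0 < x -> 0 < b -> 0 <= a -> 0 < eta + a -> entire c ->
  (forall u, 0 < u -> f u = gpower a c u) ->
  EK_pos 2 eta b f x =
  gpower a (fun k => Gamma (eta + a * k%:R + a) / Gamma (eta + a * k%:R + a + b) * c k) x.
Proof.
move=> x0 b0 a0 ea ec fE.
have sub u : (`]0, x[%classic : set R) u -> 0 < u /\ u < x.
  by rewrite /= in_itv/= => /andP[].
pose p k : R := a * k%:R + a - 1.
pose s k : R := eta + a * k%:R + a.
have sE k : eta + p k + 1 = s k by rewrite /p /s; ring.
have s0 k : 0 < s k.
  by rewrite /s addrAC ltr_wpDr// mulr_ge0.
pose T k (u : R) := EK_kernel eta b x u * u `^ (2 * p k).
have iT k : mu.-integrable `]0%R, x[ (fun u => (T k u)%:E).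
  by apply: EK_kernel_power_integrable; rewrite ?sE.
pose I k : R := x `^ (2 * (eta + p k + b)) * (Gamma (s k) * Gamma b / Gamma (s k + b)).
have TI k : (\int[mu]_(u in `]0%R, x[) (T k u)%:E = (I k)%:E)%E.
  have := @EK_kernel_power R eta b x (p k) x0 b0.
  by rewrite sE => /(_ (s0 k)).
pose S n (u : R) : \bar R := (\sum_(k <- iota 0 n) (c k)%:E * (T k u)%:E)%E.
have SE n u : S n u =
    (EK_kernel eta b x u * series (fun k => c k * u `^ (2 * p k)) n)%:E.
  rewrite /S /series/= mulr_sumr -sumEFin /index_iota subn0.
  by apply: eq_bigr => k _; rewrite -EFinM /T; congr EFin; ring.
have iS n : mu.-integrable `]0%R, x[ (S n).
  by apply: integrable_sum => // k _; exact: integrableZl.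
have intS n : (\int[mu]_(u in `]0%R, x[) S n u = (\sum_(0 <= k < n) c k * I k)%:E)%E.
  rewrite /S integral_sum//; last by move=> k; exact: integrableZl.
  rewrite -sumEFin /index_iota subn0; apply: eq_bigr => k _.
  by rewrite integralZl// TI.
pose g (u : R) := (EK_kernel eta b x u * f u)%:E.
have Sg u : (`]0, x[%classic : set R) u -> S ^~ u @ \oo --> g u.
  move=> /sub[u0 _]; rewrite /g fE//; under eq_cvg do rewrite SE.
  apply: cvg_EFin; first exact: nearW.
  by apply: cvgMl_tmp; exact: gpower_cvg.
have mS n : measurable_fun (`]0, x[%classic : set R) (S n).
  exact: measurable_int (iS n).
have mg : measurable_fun (`]0, x[%classic : set R) g.
  exact: emeasurable_fun_cvg mS Sg.
(* For u < x one has u^(2a) <= z. After the lowest power of u is factored out, every partial sum is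
   thus bounded by [M], and [M] times the k = 0 term dominates. *)
pose z := x `^ (2 * a).
pose M := limn (series (fun k => `|c k * z ^+ k|)).
have SM n u : (`]0, x[%classic : set R) u -> (`|S n u| <= (M * T 0%N u)%:E)%E.
  move=> /sub[u0 ux]; rewrite SE abse_EFin lee_fin normrM.
  rewrite (ger0_norm (EK_kernel_ge0 _ _ _ _)) /T mulrCA ler_wpM2l ?EK_kernel_ge0//.
  have y0 : 0 <= u `^ (2 * a) by exact: powR_ge0.
  have yz : u `^ (2 * a) <= z.
    apply: ge0_ler_powR; rewrite ?nnegrE.
    - by rewrite mulr_ge0.
    - exact: ltW.
    - exact: ltW.
    - exact: ltW.
  have -> : series (fun k => c k * u `^ (2 * p k)) n =
      u `^ (2 * p 0%N) * series (fun k => c k * (u `^ (2 * a)) ^+ k) n.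
    rewrite /series/= mulr_sumr; apply: eq_bigr => k _.
    by rewrite /p !powR_gpowerE// expr0 mulr1; ring.
  rewrite normrM ger0_norm ?powR_ge0// mulrC ler_wpM2r ?powR_ge0//.
  apply: (@le_trans _ _ (series (fun k => `|c k * z ^+ k|) n)).
    apply: le_trans (ler_norm_sum _ _ _) _; apply: ler_sum => k _.
    rewrite !normrM ler_wpM2l// !normrX lerXn2r ?nnegrE//.
    by rewrite !ger0_norm// (le_trans y0).
  apply: nondecreasing_cvgn_le; last exact: entire_cvg.
  by apply: nondecreasing_series => k _ _.
have iM : mu.-integrable `]0%R, x[ (fun u => (M * T 0%N u)%:E).
  suff : mu.-integrable `]0%R, x[ (fun u => M%:E * (T 0%N u)%:E)%E by [].
  exact: integrableZl.
have [ig intSg] : mu.-integrable `]0%R, x[ g /\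
    (\int[mu]_(u in `]0%R, x[) S n u)%E @[n --> \oo] --> (\int[mu]_(u in `]0%R, x[) g u)%E.
  have DC := fun mD => @dominated_convergence _ _ R mu `]0%R, x[%classic mD
    S g (fun u => (M * T 0%N u)%:E).
  case: DC => [||||||ig _ intSg].
  - exact: measurable_itv.
  - exact: mS.
  - exact: mg.
  - by apply: aeW => u; exact: Sg.
  - exact: iM.
  - by apply: aeW => u n; exact: SM.
  - by split.
have fing : (\int[mu]_(u in `]0%R, x[) g u)%E \is a fin_num.
  exact: integrable_fin_num.
pose L := fine (\int[mu]_(u in `]0%R, x[) g u)%E.
have cL : series (fun k => c k * I k) @ \oo --> L.
  have -> : series (fun k => c k * I k) =
      fine \o (fun n => (\int[mu]_(u in `]0%R, x[) S n u)%E).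
    by apply/funext => n; rewrite /= intS.
  by apply: fine_cvg; rewrite fineK.
have ratio_le k : `|Gamma (s k) / Gamma (s k + b)| <= Gamma (s 0%N) / Gamma (s 0%N + b).
  have G1 j : 0 < Gamma (s j + b) by rewrite Gamma_gt0// addr_gt0.
  have G0 j : 0 < Gamma (s j) by rewrite Gamma_gt0.
  rewrite ger0_norm; last by rewrite divr_ge0// ltW.
  apply: Gamma_ratio_antitone => //.
  by rewrite /s mulr0 addr0 addrAC lerDl mulr_ge0.
have ec' := entireM_bounded ec ratio_le.
have -> : EK_pos 2 eta b f x = x `^ (- (2 * eta) - 2 * b) / Gamma b * L.
  rewrite /EK_pos; congr (_ * _); apply: eq_Rintegral => u _.
  by rewrite /EK_kernel; ring.
(* Once the partial sums are seen to tend to the integral side, uniqueness of limits identifies it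
   with the [gpower] of the multiplied coefficients, entire by [ec']. *)
suff : series (fun k => Gamma (s k) / Gamma (s k + b) * c k * x `^ (2 * p k)) @ \oo -->
    x `^ (- (2 * eta) - 2 * b) / Gamma b * L.
  move=> h; rewrite -(cvg_lim _ h)//.
  by apply/cvg_lim => //; exact: gpower_cvg ec' x0.
have -> : series (fun k => Gamma (s k) / Gamma (s k + b) * c k * x `^ (2 * p k)) =
    (fun n => x `^ (- (2 * eta) - 2 * b) / Gamma b * series (fun k => c k * I k) n).
  apply/funext => n; rewrite /series/= mulr_sumr; apply: eq_bigr => k _.
  have -> : 2 * p k = - (2 * eta) - 2 * b + 2 * (eta + p k + b) by ring.
  rewrite (powR_gt0D (- (2 * eta) - 2 * b) _ x0) /I.
  move: (Gamma_gt0 b0) (Gamma_gt0 (addr_gt0 (s0 k) b0)) => /lt0r_neq0 + /lt0r_neq0.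
  move: (Gamma _) (Gamma _) (Gamma _) => g1 g2 g3 n1 n2.
  by field; rewrite n1 n2.
by apply: cvgMl_tmp.
Qed.

(** [f] is known only on the positive half-line, a neighbourhood of y, which determines the
    derivative there. *)
Lemma mul_derive1_gpower (R : realType) (a y : R) (c : nat -> R) (f : R -> R) :
  entire c -> (forall u, 0 < u -> f u = gpower a c u) -> 0 < y ->
  y * derive1 f y = gpower a (fun k => (2 * a * k%:R + 2 * (a - 1)) * c k) y.
Proof.
move=> ec fE y0; have [_ D] := is_derive_gpower a ec y0.
rewrite derive1E (@near_eq_derive _ _ _ f (gpower a c)).
  by rewrite D mulrA mulfV ?mul1r// gt_eqF.
by near=> u; apply: fE; near: u; exact: lt_nbhsr.
Unshelve. all: by end_near. Qed.

Lemma entireD (R : realType) (b c : nat -> R) :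
  entire b -> entire c -> entire (fun k => b k + c k).
Proof.
move=> eb ec r r0; have [M bM] := eb r r0; have [M' cM] := ec r r0.
exists (M + M') => k; apply: le_trans (lerD (bM k) (cM k)); rewrite -mulrDl.
by rewrite ler_wpM2r ?ler_normD// exprn_ge0// ltW.
Qed.

Lemma entireZ (R : realType) (x : R) (b : nat -> R) :
  entire b -> entire (fun k => x * b k).
Proof. by move=> eb; exact: (@entireM_bounded _ b (fun=> x) `|x| eb (fun=> lexx _)). Qed.

(* Multiplier of EK_iter n on w^(2(s - eta - 1)): the product telescopes the
   Gamma quotient down to Gamma s / Gamma (s + al), and still makes sense (as 0)
   when s + al = 0, where Gamma has its junk value. *)
Definition EK_factor (R : realType) (n : nat) (al s : R) : R :=
  \prod_(i < n) (s + al + i%:R) * (Gamma s / Gamma (s + al + n%:R)).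

(** Induction on [n] with order, coefficients and function all varying: one recursion step uses the
    hypothesis at order al + 1 for both f and x f'. Entireness is carried along because adding the
    two series requires it. *)
Lemma EK_iter_gpower (R : realType) (n : nat) (eta al a : R) (c : nat -> R) (f : R -> R) :
  0 < al + n%:R -> 0 <= a -> 0 < eta + a -> entire c ->
  (forall u, 0 < u -> f u = gpower a c u) ->
  entire (fun k => EK_factor n al (eta + a * k%:R + a) * c k) /\
  (forall x, 0 < x -> EK_iter n 2 eta al f x =
    gpower a (fun k => EK_factor n al (eta + a * k%:R + a) * c k) x).
Proof.
move=> + a0 ea; elim: n => [|n IH] in al c f *.
  rewrite addr0 => al0 ec fE.
  have E0 s : EK_factor 0 al s = Gamma s / Gamma (s + al).
    by rewrite /EK_factor big_ord0 mul1r addr0.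
  have s0 k : 0 < eta + a * k%:R + a by rewrite addrAC ltr_wpDr// mulr_ge0.
  under eq_fun do rewrite E0.
  split; last by move=> x x0; exact: EK_pos_gpower.
  apply: (@entireM_bounded _ _ _ (Gamma (eta + a) / Gamma (eta + a + al))) => // k.
  rewrite ger0_norm; last by rewrite divr_ge0// ltW// Gamma_gt0// addr_gt0.
  by apply: Gamma_ratio_antitone => //; rewrite addrAC lerDl mulr_ge0.
move=> aln ec fE.
have {}aln : 0 < al + 1 + n%:R by rewrite -addrA nat1r.
have ed := entireM_affine (2 * a) (2 * (a - 1)) ec.
have [e1 E1] := IH _ _ _ aln ec fE.
have [e2 E2] := IH _ _ _ aln ed (fun y => mul_derive1_gpower ec fE).
have factorE k : EK_factor n.+1 al (eta + a * k%:R + a) * c k =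
    (eta + al + 1) * (EK_factor n (al + 1) (eta + a * k%:R + a) * c k) +
    2^-1 * (EK_factor n (al + 1) (eta + a * k%:R + a) *
      ((2 * a * k%:R + 2 * (a - 1)) * c k)).
  rewrite /EK_factor big_ord_recl/= addr0; set s := eta + _ + a.
  have -> : \prod_(i < n) (s + al + (bump 0 i)%:R) = \prod_(i < n) (s + (al + 1) + i%:R).
    by apply: eq_bigr => i _; rewrite /bump/= natrD; ring.
  have -> : s + al + n.+1%:R = s + (al + 1) + n%:R by rewrite -natr1; ring.
  set g := Gamma s / _; set P := \prod_(i < n) _.
  (* The new factor of the product: eta + al + 1 from the first summand of the recursion, plus half
     the exponent 2 (s - eta - 1) from x d/dx. *)
  have -> : s + al = eta + al + 1 + 2^-1 * (2 * a * k%:R + 2 * (a - 1)).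
    by rewrite /s; field.
  by ring.
under eq_fun do rewrite factorE.
split.
  by apply: entireD; exact: entireZ.
by move=> x x0; rewrite /= E1// E2// gpowerD.
Qed.

Lemma EK_factor_pole (R : realType) (n : nat) (al : R) :
  EK_factor n.+1 al (- al) = 0.
Proof. by rewrite /EK_factor big_ord_recl/= addNr add0r !mul0r. Qed.

Lemma EK_factorE (R : realType) (n : nat) (al s : R) :
  0 < s + al -> EK_factor n al s = Gamma s / Gamma (s + al).
Proof.
move=> s0; rewrite /EK_factor Gamma_addn// invfM mulrCA mulrA mulrC.
have G0 := Gamma_gt0 s0.
have P0 : \prod_(i < n) (s + al + i%:R) != 0.
  by apply/prodf_neq0 => i _; rewrite gt_eqF// ltr_wpDr.
by field; rewrite P0 gt_eqF.
Qed.

(** Hides the number of recursion steps. The multiplier at index k has denominator Gamma (eta + a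
    k), whose argument is positive except for eta = 0 and k = 0; there the vanishing first factor of
    [EK_factor] gives 0. *)
Lemma EKN_gpower (R : realType) (eta a : R) (c : nat -> R) (f : R -> R) :
  0 < a -> 0 <= eta -> entire c ->
  (forall u, 0 < u -> f u = gpower a c u) ->
  exists d : nat -> R, [/\ entire d,
    forall k, 0 < eta + a * k%:R ->
      d k = Gamma (eta + a * k%:R + a) / Gamma (eta + a * k%:R) * c k,
    eta = 0 -> d 0%N = 0 &
    forall x, 0 < x -> EK 2 eta (- a) f x = gpower a d x].
Proof.
move=> a0 eta0 ec fE; pose n := (Num.truncn a).+1.
have an : 0 < - a + n%:R by rewrite addrC subr_gt0 truncnS_gt.
have [ed dE] := EK_iter_gpower an (ltW a0) (ltr_wpDl eta0 a0) ec fE.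
exists (fun k => EK_factor n (- a) (eta + a * k%:R + a) * c k); split => //.
- by move=> k s0; rewrite EK_factorE addrK.
- move=> ->; rewrite mulr0 !add0r.
  by have := EK_factor_pole (Num.truncn a) (- a); rewrite opprK -/n => ->; rewrite mul0r.
- have steps : EK_steps (- a) = n.
    by rewrite /EK_steps oppr_gt0 ltNge (ltW a0) opprK.
  by move=> x x0; rewrite /EK steps dE.
Qed.

(** * The coefficients of the solution, and the equation *)

Definition sol_coef (R : realType) (N : nat) (a lam c : R) (k : nat) : R :=
  (lam / (2 `^ a * c `^ a)) ^+ (2 * k) *
  ((-1) ^+ k / (Gamma (a * k%:R + a + (N%:R - 1) / 2) * Gamma (a * k%:R + a))).

(** One reciprocal Gamma factor is entire. The other is bounded, by [Gamma_ge] at M = 1, so together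
    with the powers of [q] it grows at most geometrically. *)
Lemma entire_sol_coef (R : realType) (N : nat) (a lam c : R) :
  (1 <= N)%N -> 0 < a -> entire (sol_coef N a lam c).
Proof.
move=> N1 a0; pose eta : R := (N%:R - 1) / 2.
have eta0 : 0 <= eta by rewrite divr_ge0// subr_ge0 ler1n.
have eG := entire_Gamma_inv a0.
pose q := lam / (2 `^ a * c `^ a).
pose D : R := expR (- (1 + 1)) / (1 + 1).
have D0 : 0 < D by rewrite divr_gt0 ?expR_gt0.
(* The rate is q^2 + 1 rather than q^2 because it must be positive, and [q] vanishes when [lam]
   does. *)
have := @entireM_geometric _ _ (fun k => q ^+ (2 * k) *
  ((-1) ^+ k / Gamma (a * k%:R + a + eta))) D^-1 (q ^+ 2 + 1) _ eG.
have q0 : 0 < q ^+ 2 + 1 by rewrite ltr_wpDl// sqr_ge0.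
move=> /(_ q0) H.
suff -> : sol_coef N a lam c = (fun k => q ^+ (2 * k) *
   ((-1) ^+ k / Gamma (a * k%:R + a + eta)) * (Gamma (a * k%:R + a))^-1).
  apply: H => k.
  have s0 : 0 < a * k%:R + a + eta.
    by rewrite ltr_wpDr// ltr_wpDl// mulr_ge0// ltW.
  have G0 := Gamma_gt0 s0.
  rewrite !normrM !normrX normrN1 expr1n mul1r mulrC.
  apply: ler_pM => //.
    rewrite ger0_norm ?invr_ge0 ?(ltW G0)// lef_pV2 ?posrE//.
    by have := Gamma_ge s0 ltr01; rewrite powR1 mul1r.
  by rewrite exprM lerXn2r ?nnegrE ?sqr_ge0 ?(ltW q0)// real_normK ?num_real// lerDl.
apply/funext => k; rewrite /sol_coef -/q -/eta invfM.
by ring.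
Qed.

Lemma sol_termE (R : realType) (N : nat) (a lam c w : R) : 0 < w ->
  sol_term N a lam c (w ^+ 2) =
  (fun k => sol_coef N a lam c k * w `^ (2 * (a * k%:R + a - 1))).
Proof.
by move=> w0; apply/funext => k; rewrite /sol_term sqr_powR// /sol_coef; ring.
Qed.

Unset Implicit Arguments.

Theorem theorem3p2 (R : realType) (N : nat) (a lam c : R) :
  (1 <= N)%N -> 0 < a <= 1 -> 0 < c ->
  [/\ (* the defining series converges *)
      (forall s : R, 0 < s -> cvgn (series (sol_term N a lam c s))),
      (* u_alpha is of the form f(w), and equals the Mittag-Leffler expression *)
      (forall (x : 'I_N -> R) (t : R), 0 < sq_interval c x t ->
         @u_sol R N a lam c x t = f_sol N a lam c (Num.sqrt (sq_interval c x t)) /\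
         @u_sol R N a lam c x t =
           sq_interval c x t `^ (a - 1) *
           mittag_leffler_multi (n := 2) (fun _ => a)
             (fun i => if i == ord0 then a else a + (N%:R - 1) / 2)
             (- (lam * sq_interval c x t `^ (a / 2) / (2 `^ a * c `^ a)) ^+ 2)) &
      (* f solves the fractional equation for every w > 0 *)
      (forall w : R, 0 < w ->
         frac_bessel N a (f_sol N a lam c) w = - (lam ^+ 2 / c `^ (2 * a)) * f_sol N a lam c w)].
Proof.
move=> N1 /andP[a0 _] c0.
have eB := entire_sol_coef lam c N1 a0.
set B := sol_coef N a lam c in eB.
pose eta : R := (N%:R - 1) / 2.
have eta0 : 0 <= eta by rewrite divr_ge0// subr_ge0 ler1n.
have cvgw w : 0 < w -> series (sol_term N a lam c (w ^+ 2)) @ \oo --> gpower a B w.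
  by move=> w0; rewrite sol_termE//; exact: gpower_cvg.
have fE w : 0 < w -> f_sol N a lam c w = gpower a B w.
  by move=> w0; apply/cvg_lim => //; exact: cvgw.
have sK (s : R) : 0 < s -> Num.sqrt s ^+ 2 = s by move=> s0; rewrite sqr_sqrtr// ltW.
split.
- move=> s s0; apply/cvg_ex; exists (gpower a B (Num.sqrt s)).
  by rewrite -{1}(sK s s0); apply: cvgw; rewrite sqrtr_gt0.
- move=> x t; set s := sq_interval c x t => s0; split.
    by rewrite /u_sol /f_sol sK.
  have r0 : 0 < Num.sqrt s by rewrite sqrtr_gt0.
  have -> : @u_sol R N a lam c x t = gpower a B (Num.sqrt s).
    by rewrite -fE// /u_sol /f_sol sK.
  (* With w^2 = s the prefactor is s^(a-1) and the series variable is s^a; it remains to match the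
     two series term by term. *)
  rewrite /gpower -!sqr_powR// sK//; congr (_ * _).
  congr (limn (series _)); apply/funext => k.
  rewrite !big_ord_recl big_ord0 mulr1/= /B /sol_coef.
  pose q := lam / (2 `^ a * c `^ a).
  have -> : (lam * s `^ (a / 2) / (2 `^ a * c `^ a)) ^+ 2 = q ^+ 2 * s `^ a.
    rewrite mulrAC -/q exprMn -(@powR_mulrn _ (s `^ _)) ?powR_ge0// -powRrM.
    by rewrite divfK.
  rewrite -/q; clearbody q.
  rewrite [in RHS]exprNn [in RHS]exprMn exprM addrA [Gamma _ * Gamma (_ + a)]mulrC.
  by ring.
- move=> w w0.
  have [d [ed dE _ fd]] := EKN_gpower a0 eta0 eB fE.
  have [d' [ed' dE' d'0 fd']] := EKN_gpower a0 (lexx 0) ed fd.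
  rewrite /frac_bessel (fd' w w0) fE// -/eta.
  pose q := lam / (2 `^ a * c `^ a).
  (* At index k + 1 the two multipliers cancel both Gamma factors of [B k.+1] and put those of [B k]
     in their place; the surplus q^2 and sign remain. *)
  have d'S k : d' k.+1 = - q ^+ 2 * B k.
    have ak : 0 <= a * k%:R by rewrite mulr_ge0// ltW.
    have akS : a * k.+1%:R = a * k%:R + a by rewrite -natr1 mulrDr mulr1.
    have s1 : 0 < a * k%:R + a by rewrite ltr_wpDl.
    have s2 : 0 < a * k%:R + a + eta by rewrite ltr_wpDr.
    have e2 : eta + a * k.+1%:R = a * k%:R + a + eta by rewrite akS addrC.
    rewrite dE' add0r akS// dE ?e2// /B /sol_coef -/q -/eta akS.
    have -> : a * k%:R + a + eta + a = a * k%:R + a + a + eta by ring.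
    have G1 := Gamma_gt0 s1; have G2 := Gamma_gt0 s2.
    have G3 : 0 < Gamma (a * k%:R + a + a) by rewrite Gamma_gt0// addr_gt0.
    have G4 : 0 < Gamma (a * k%:R + a + a + eta).
      by rewrite Gamma_gt0// ltr_wpDr// addr_gt0.
    rewrite mulnS exprD [(-1) ^+ k.+1]exprS; clearbody q.
    move: G1 G2 G3 G4 => /lt0r_neq0 + /lt0r_neq0 + /lt0r_neq0 + /lt0r_neq0.
    move: (Gamma _) (Gamma _) (Gamma _) (Gamma _) => g1 g2 g3 g4 n1 n2 n3 n4.
    by field; rewrite n1 n2 n3 n4.
  have shift : limn (pseries d' (w `^ (2 * a))) =
      - q ^+ 2 * w `^ (2 * a) * limn (pseries B (w `^ (2 * a))).
    (* As [d' 0] is 0, the sum starts at index 1, and reindexing releases one factor w^(2a). *)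
    apply/cvg_lim => //; rewrite -cvg_shiftS.
    have -> : (fun n => pseries d' (w `^ (2 * a)) n.+1) =
       (fun n => - q ^+ 2 * w `^ (2 * a) * pseries B (w `^ (2 * a)) n).
      apply/funext => n; rewrite /pseries /series/= big_nat_recl// d'0// mul0r add0r.
      by rewrite mulr_sumr; apply: eq_bigr => k _; rewrite d'S [_ ^+ k.+1]exprS; ring.
    by apply: cvgMl_tmp; exact: entire_pseries_cvg.
  (* Now w^(-2a) cancels the released w^(2a), and 4^a cancels the (2^a)^2 in the denominator of
     q^2. *)
  rewrite /gpower shift powRN.
  have z0 : 0 < w `^ (2 * a) by exact: powR_gt0.
  have -> : (4 : R) `^ a = (2 `^ a) ^+ 2.
    rewrite -(@powR_mulrn _ (2 `^ a)) ?powR_ge0// -powRrM mulrC powRrM powR_mulrn//.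
    by congr (_ `^ _); ring.
  have -> : c `^ (2 * a) = (c `^ a) ^+ 2.
    by rewrite -(@powR_mulrn _ (c `^ a)) ?powR_ge0// -powRrM mulrC.
  have ca : c `^ a != 0 by rewrite gt_eqF// powR_gt0.
  have t2 : (2 : R) `^ a != 0 by rewrite gt_eqF// powR_gt0.
  rewrite /q; field.
  by rewrite ca t2 gt_eqF.
Qed.
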